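(* Let $H_1,H_2$ be graphs with $2\le\chi(H_1)<\chi(H_2)$. Then $$\delta_{\mathrm{VC}}(H_1)\le\delta_{\mathrm B}(H_1)<\delta_{\mathrm{VC}}(H_2)\le\delta_{\mathrm B}(H_2).$$
   Context: All graphs are finite and simple. A graph is $H$-free if it contains no (not necessarily induced) subgraph isomorphic to $H$; it is maximal $H$-free if it is $H$-free and adding any missing edge creates a copy of $H$. $\delta(G)$ denotes minimum degree and $\chi$ the chromatic number. The VC-dimension $\mathrm{VC}(G)$ of a graph $G$ is the maximum size of a set $S\subseteq V(G)$ such that $\{N_G(v)\cap S: v\in V(G)\}=2^S$. The VC-dimension threshold $\delta_{\mathrm{VC}}(H)$ is the infimum of all $\gamma\ge 0$ for which there exists a constant $C=C(\gamma,H)$ such that every maximal $H$-free graph $G$ with $\delta(G)\ge\gamma|V(G)|$ satisfies $\mathrm{VC}(G)\le C$. A blowup of a graph $F$ is obtained by replacing each vertex of $F$ by a (possibly empty) independent set and each edge of $F$ by a complete bipartite graph between the corresponding sets. The blowup threshold $\delta_{\mathrm B}(H)$ is the infimum of all $\gamma\ge 0$ for which there exists a (finite) graph $F=F(\gamma,H)$ such that every maximal $H$-free graph $G$ with $\delta(G)\ge\gamma|V(G)|$ is a blowup of $F$. *)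

(* Defs.v *)
From HB Require Import structures.
From mathcomp Require Import all_boot all_order all_algebra.
From mathcomp Require Import classical_sets reals.

Set Implicit Arguments.
Unset Strict Implicit.
Unset Printing Implicit Defensive.

Import Order.TTheory GRing.Theory Num.Theory.

Local Open Scope ring_scope.

Record sgraph := SGraph {
  vertex :> finType;
  edge : rel vertex;
  edge_sym : symmetric edge;
  edge_irrefl : irreflexive edge
}.

Definition contains_copy (H G : sgraph) : Prop :=
  exists2 f : H -> G, injective f &
    forall x y, edge x y -> edge (f x) (f y).

Definition copy_free (H G : sgraph) : Prop := ~ contains_copy H G.

Definition isomorphic (G G' : sgraph) : Prop :=
  exists2 f : G -> G', bijective f &
    forall x y, edge (f x) (f y) = edge x y.

Section AddEdge.
Variables (G : sgraph) (u v : G).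

(* If u = v nothing is added, so that the result is again loopless. *)
Definition add_edge_rel : rel G := fun x y =>
  edge x y ||
  (u != v) && (((x == u) && (y == v)) || ((x == v) && (y == u))).

Lemma add_edge_sym : symmetric add_edge_rel.
Proof.
by move=> x y; rewrite /add_edge_rel edge_sym; do !case: eqP => //=.
Qed.

Lemma add_edge_irrefl : irreflexive add_edge_rel.
Proof.
move=> x; rewrite /add_edge_rel edge_irrefl /=.
have [//|/negPf uv /=] := eqVneq u v.
by have [->|] := eqVneq x u; rewrite ?uv ?andbF.
Qed.

Definition add_edge : sgraph := SGraph add_edge_sym add_edge_irrefl.

End AddEdge.

Definition maximal_copy_free (H G : sgraph) : Prop :=
  copy_free H G /\
  forall u v : G, u != v -> ~~ edge u v -> contains_copy H (add_edge u v).

Definition neighbours (G : sgraph) (v : G) : {set G} :=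
  [set w | edge v w]%SET.

(* The default #|G| exceeds every degree, so it only matters for the graph
   without vertices, which gets minimum degree 0. *)
Definition min_degree (G : sgraph) : nat :=
  \big[minn/#|G|]_(v : G) #|neighbours v|.

Definition colorable (G : sgraph) (k : nat) : bool :=
  [exists c : {ffun G -> 'I_k},
    [forall x, forall y, edge x y ==> (c x != c y)]].

Lemma colorable_exists (G : sgraph) : exists k, colorable G k.
Proof.
exists #|G|; apply/existsP; exists [ffun x => enum_rank x].
apply/forallP => x; apply/forallP => y; apply/implyP; rewrite !ffunE.
by apply: contraTneq => /enum_rank_inj ->; rewrite edge_irrefl.
Qed.

Definition chromatic_number (G : sgraph) : nat := ex_minn (colorable_exists G).

Definition shattered (G : sgraph) (S : {set G}) : bool :=
  ([set neighbours v :&: S | v : G] == powerset S)%SET.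

(* The empty set is shattered as soon as G has a vertex; the graph without
   vertices shatters no set and gets VC-dimension 0. *)
Definition VC (G : sgraph) : nat := \max_(S : {set G} | shattered S) #|S|.

Section Blowup.
Variables (F : sgraph) (n : F -> nat).

Definition blowup_rel : rel {x : F & 'I_(n x)} :=
  fun p q => edge (tag p) (tag q).

Lemma blowup_sym : symmetric blowup_rel.
Proof. by move=> p q; apply: edge_sym. Qed.

Lemma blowup_irrefl : irreflexive blowup_rel.
Proof. by move=> p; apply: edge_irrefl. Qed.

Definition blowup : sgraph := SGraph blowup_sym blowup_irrefl.

End Blowup.

Definition is_blowup (G F : sgraph) : Prop :=
  exists n : F -> nat, isomorphic G (blowup n).

(* Both sets below are bounded below by 0 and contain 1, as a graph G with a
   vertex has minimum degree less than #|G|; so inf is a genuine infimum. *)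
Definition delta_VC (R : realType) (H : sgraph) : R :=
  inf [set gamma : R | 0 <= gamma /\
    exists C : nat, forall G : sgraph,
      maximal_copy_free H G -> gamma * #|G|%:R <= (min_degree G)%:R ->
      (VC G <= C)%N]%classic.

Definition delta_B (R : realType) (H : sgraph) : R :=
  inf [set gamma : R | 0 <= gamma /\
    exists F : sgraph, forall G : sgraph,
      maximal_copy_free H G -> gamma * #|G|%:R <= (min_degree G)%:R ->
      is_blowup G F]%classic.

(* Main.v *)
Require Import Defs.
From mathcomp Require Import all_boot all_order all_algebra all_fingroup.
From mathcomp Require Import boolp reals zify ring lra.

Set Implicit Arguments.
Unset Strict Implicit.
Unset Printing Implicit Defensive.

(** A shattered set contains no twins, so a blowup of F has VC-dimension at most
    |F|, which gives the two outer inequalities.  Let chi(H2) = q + 3 and h = |H2|.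

    Since H1 is (q + 2)-colourable, the minimum degree form of the Erdos-Stone
    theorem bounds the order of the H1-free graphs of minimum degree at least
    gamma n, for any gamma > q / (q + 1); they are then all blowups of one graph.

    For the lower bound on delta_VC(H2), let K be minimal in the homomorphism order
    among the graphs such that H2 maps to the join of K with a complete graph on q
    vertices, and let K be a core.  It is not bipartite; take an edge xy of a
    minimal non-bipartite induced subgraph.  A suitable K-partite graph has no
    section over K, but contains vertices a_A and b_i in the classes of x and y
    (for A a subset of [m] and i in [m]) with a_A b_i an edge iff i is in A, and
    joining a_A to b_i creates a section if i is not in A.  Blow it up, attach to
    each class a set of new common neighbours, and join the result with q
    independent sets: the graph obtained is H2-free of minimum degree at least
    gamma0 n, where gamma0 > q / (q + 1) does not depend on m.  In a maximal H2-free
    supergraph, the density between the blown-up a_A and b_i, i not in A, is small,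
    as otherwise a large complete bipartite graph there would yield a copy of H2.
    So one can choose representatives with the same adjacencies as before, and
    these shatter a set of size m. *)

(** * VC-dimension, blowups and a universal finite graph *)

Lemma shatter_le_VC (G : sgraph) (m : nat) (a : {set 'I_m} -> G) (b : 'I_m -> G) :
  (forall A i, edge (a A) (b i) = (i \in A)) -> m <= VC G.
Proof.
move=> ab.
have bI : injective b.
  by move=> i j eb; have := ab [set i] j; rewrite -eb ab !inE eqxx => /esym/eqP.
have S_card : #|[set b i | i : 'I_m]%SET| = m.
  by rewrite card_imset // card_ord.
rewrite -[X in X <= _]S_card.
apply: (leq_bigmax_cond (F := fun S : {set G} => #|S|)).
apply/eqP/setP => B; rewrite powersetE; apply/imsetP/idP => [[v _ ->]|/subsetP BS].
  exact: subsetIr.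
exists (a [set i | b i \in B]%SET) => //; apply/setP => w; rewrite !inE.
apply/idP/andP => [wB|[e /imsetP [i _ ew]]].
  split; last exact: BS.
  by have /imsetP [i _ ew] := BS _ wB; rewrite ew ab inE -ew.
by move: e; rewrite ew ab inE.
Qed.

Lemma VC_blowup (G F : sgraph) : is_blowup G F -> VC G <= #|F|.
Proof.
case=> n [f _ fE]; apply/bigmax_leqP => S /eqP shS.
have tagI : {in S &, injective (fun v => tag (f v))}.
  move=> u v uS vS euv; apply/eqP; apply: contraT => uv.
  have : [set u]%SET \in powerset S by rewrite powersetE sub1set.
  rewrite -shS => /imsetP [w _ /setP eq1].
  have := eq1 u; have := eq1 v; rewrite !inE eqxx uS vS !andbT -!fE.
  rewrite /= /blowup_rel /= euv => <- /esym/eqP ev.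
  by rewrite ev eqxx in uv.
by rewrite -(card_in_imset tagI) max_card.
Qed.

Section UniversalGraph.
Variable N : nat.

(** This is the disjoint union of all labelled graphs on ['I_N]; testing both orders of the pair
    symmetrises an arbitrary first component. *)
Definition universal_rel : rel ({ffun 'I_N * 'I_N -> bool} * 'I_N) := fun p q =>
  [&& p.1 == q.1, p.2 != q.2, p.1 (p.2, q.2) & p.1 (q.2, p.2)].

Lemma universal_sym : symmetric universal_rel.
Proof.
move=> [r i] [r' j]; rewrite /universal_rel /= (eq_sym r') (eq_sym j).
by case: eqP => [->|//]; case: (i == j); rewrite //= andbC.
Qed.

Lemma universal_irrefl : irreflexive universal_rel.
Proof. by move=> p; rewrite /universal_rel eqxx /= eqxx. Qed.

Definition universal : sgraph := SGraph universal_sym universal_irrefl.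

Lemma universal_blowup (G : sgraph) : #|G| <= N -> is_blowup G universal.
Proof.
move=> leGN; pose g (v : G) : 'I_N := widen_ord leGN (enum_rank v).
have gI : injective g by move=> u v [/ord_inj/enum_rank_inj].
pose r : {ffun 'I_N * 'I_N -> bool} :=
  [ffun p => [exists u, exists v, [&& g u == p.1, g v == p.2 & edge u v]]].
have rE u v : r (g u, g v) = edge u v.
  rewrite ffunE; apply/existsP/idP => [[u' /existsP [v' /and3P [/eqP/gI eu /eqP/gI ev]]]|e].
    by rewrite eu ev.
  by exists u; apply/existsP; exists v; rewrite !eqxx.
(* With class size 1 on the copy of [G] and 0 elsewhere, the blowup is an induced subgraph. *)
pose n (p : universal) : nat := (p.1 == r) && [exists v, g v == p.2].
have nE v : n (r, g v) = 1.
  by rewrite /n /= eqxx; case: existsP => // -[]; exists v.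
pose f (v : G) : blowup n :=
  Tagged (fun p : universal => 'I_(n p)) (cast_ord (esym (nE v)) ord0).
exists n; exists f; last first.
  move=> u v; rewrite /= /blowup_rel /= /universal_rel /= eqxx !rE (edge_sym v u) andbb /=.
  case: (eqVneq (g u)) => //= /gI ->; exact/esym/edge_irrefl.
have fI : injective f by move=> u v /(congr1 (fun p => (tag p).2)) /= /gI.
have fS p : exists v, f v = p.
  case: p => [[r0 i] k]; have: n (r0, i) > 0 by apply: leq_ltn_trans (ltn_ord k).
  rewrite /n lt0b /= => /andP [/eqP e /existsP [v /eqP ev]]; exists v.
  subst r0 i; congr existT; apply: val_inj => /=.
  by case: k => k /=; rewrite nE ltnS leqn0 => /eqP.
apply: inj_card_bij => //.
have [g' g'K] := choice fS.
by apply: (leq_card g') => p p' e; rewrite -(g'K p) e g'K.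
Qed.

End UniversalGraph.

(** * Minimum degree and maximal extensions *)

Lemma edge_neq (G : sgraph) (u v : G) : edge u v -> u != v.
Proof. by apply: contraTneq => ->; rewrite edge_irrefl. Qed.

Lemma min_degree_le (G : sgraph) (v : G) : min_degree G <= #|neighbours v|.
Proof.
rewrite /min_degree; have := mem_index_enum v.
elim: (index_enum _) => // w s IHs; rewrite big_cons inE geq_min.
by case/predU1P => [<-|/IHs ->]; rewrite ?leqnn ?orbT.
Qed.

Lemma le_min_degree (G : sgraph) (d : nat) :
  d <= #|G| -> (forall v : G, d <= #|neighbours v|) -> d <= min_degree G.
Proof.
move=> dG dN; rewrite /min_degree; elim/big_rec: _ => // v n _ dn.
by rewrite leq_min dN.
Qed.

(** Missing edges are added one by one. The vertex type stays fixed, so that named vertices of [G]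
    survive in the extension. *)
Lemma extend_maximal (H G : sgraph) : copy_free H G ->
  exists (e : rel G) (es : symmetric e) (ei : irreflexive e),
    maximal_copy_free H (SGraph es ei) /\ subrel (edge (s := G)) e.
Proof.
have [n] := ubnP #|[set p : G * G | ~~ edge p.1 p.2]%SET|.
elim: n => // n IHn in G * => leGn Gfree.
have [Gmax|/existsNP [u /existsNP [v /not_implyP [uv /not_implyP [nuv nH]]]]] :=
  pselect (forall u v : G, u != v -> ~~ edge u v -> contains_copy H (add_edge u v)).
  exists (edge (s := G)), (@edge_sym G), (@edge_irrefl G); split=> //.
have [|e [es [ei [emax esub]]]] := IHn (add_edge u v) _ nH; last first.
  exists e, es, ei; split=> // a b eab; apply: esub.
  by rewrite /= /add_edge_rel eab.
rewrite -ltnS; apply: leq_trans leGn; rewrite ltnS.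
apply: proper_card; apply/properP; split.
  by apply/subsetP => p; rewrite !inE /= /add_edge_rel negb_or => /andP [].
by exists (u, v); rewrite !inE //= /add_edge_rel uv !eqxx /= orbT.
Qed.

(** * The minimum degree form of the Erdos-Stone theorem *)

Lemma pigeonhole (I T : finType) (p : I -> T) (A : {set I}) (B : {set T}) (t : nat) :
  (forall i, i \in A -> p i \in B) -> #|B| * t < #|A| ->
  exists c, t < #|[set i in A | p i == c]%SET|.
Proof.
move=> pB lt; apply/existsP; apply: contraLR lt; rewrite negb_exists => /forallP H.
rewrite -leqNgt -sum1_card (partition_big p (mem B)) //= -sum_nat_const.
apply: leq_sum => c _; have := H c; rewrite -leqNgt; apply: leq_trans.
by rewrite sum1dep_card.
Qed.

(** The first [j] parts are pairwise disjoint because edges are irreflexive. *)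
Definition complete_multipartite_in (G : sgraph) (j t : nat) : Prop :=
  exists P : nat -> {set G}, (forall i, i < j -> t <= #|P i|) /\
    forall i i' u v, i < j -> i' < j -> i != i' -> u \in P i -> v \in P i' -> edge u v.

Lemma exists_subset_card (T : finType) (A : {set T}) (t : nat) :
  t <= #|A| -> exists2 B : {set T}, B \subset A & #|B| = t.
Proof.
move=> tA; exists [set x in take t (enum A)]%SET.
  by apply/subsetP => x; rewrite inE => /mem_take; rewrite mem_enum.
have uT : uniq (take t (enum A)) by rewrite take_uniq // enum_uniq.
rewrite cardsE (card_uniqP uT) size_take -cardE.
by case: ltngtP tA.
Qed.

Lemma multipartite_copy (H G : sgraph) (j : nat) :
  colorable H j -> complete_multipartite_in G j #|H| -> contains_copy H G.
Proof.
move=> /existsP [c /forallP cP] [P [Pt Pe]].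
pose s (v : H) := enum (P (c v)).
have lt v : enum_rank v < size (s v).
  by rewrite -cardE; apply: leq_trans (ltn_ord _) (Pt _ (ltn_ord _)).
(* No default vertex of [G] is at hand for [nth], so [g] is specified for every default. *)
have [g gE] : {g : H -> G & forall v w, nth w (s v) (enum_rank v) = g v}.
  apply: (choice (P := fun v w' => forall w, nth w (s v) (enum_rank v) = w')) => v.
  case E: (s v) (lt v) => [//|w s'] l.
  by exists (nth w (w :: s') (enum_rank v)) => w'; apply: set_nth_default.
have gin v : g v \in P (c v).
  by rewrite -mem_enum -(gE v (g v)) mem_nth.
exists g => [u v eg|u v euv]; last first.
  apply: Pe (gin u) (gin v); rewrite ?ltn_ord //.
  by have /forallP /(_ v) /implyP /(_ euv) := cP u.
have [ec|nc] := eqVneq (c u) (c v).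
  have es : s v = s u by rewrite /s ec.
  have ltv := lt v; rewrite es in ltv.
  have /eqP := etrans (gE u (g u)) (etrans eg (esym (gE v (g u)))).
  by rewrite es nth_uniq ?enum_uniq //; move/eqP/ord_inj/enum_rank_inj.
have : edge (g u) (g v) by apply: Pe (gin u) (gin v); rewrite ?ltn_ord.
by rewrite eg edge_irrefl.
Qed.

(* A vertex with fewer than [t] neighbours in some part misses almost all of it;
   counting non-edges, at least [#|G| / (2 * b - 1)] vertices are not of this kind,
   and [t] of them see the same subset of the parts. *)
Lemma multipartite_step (G : sgraph) (a b j t : nat) :
  0 < t -> j * a < b ->
  (forall v : G, b * (#|G| - #|neighbours v|) <= a * #|G|) ->
  2 * b * (2 ^ (j * (2 * b * t)) * t) <= #|G| ->
  complete_multipartite_in G j (2 * b * t) -> complete_multipartite_in G j.+1 t.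
Proof.
move=> t0 jab deg nbig [P0 [P0t P0e]].
have [P PP] : {P : nat -> {set G} &
    forall i, i < j -> P i \subset P0 i /\ #|P i| = 2 * b * t}.
  apply: (choice (P := fun i (B : {set G}) => i < j -> B \subset P0 i /\ #|B| = 2 * b * t)) => i.
  have [ij|_] := boolP (i < j); last by exists set0.
  by have [B sB cB] := exists_subset_card (P0t _ ij); exists B.
have Pe i i' u v : i < j -> i' < j -> i != i' -> u \in P i -> v \in P i' -> edge u v.
  move=> ij ij' ii' uP vP; have [/subsetP s1 _] := PP _ ij.
  have [/subsetP s2 _] := PP _ ij'; exact: P0e ij ij' ii' (s1 _ uP) (s2 _ vP).
pose T := 2 * b * t.
pose good := [set v : G | [forall i : 'I_j, t <= #|P i :&: neighbours v|]]%SET.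
pose X := (\bigcup_(i < j) P i)%SET.
have XT : #|X| <= j * T.
  apply: leq_trans (_ : \sum_(i < j) #|P i| <= _).
    rewrite /X; elim/big_rec2: _ => [|i n B _ IH]; first by rewrite cards0.
    by apply: leq_trans (leq_card_setU _ _) _; rewrite leq_add2l.
  rewrite (eq_bigr (fun=> T)) ?sum_nat_const ?card_ord // => i _.
  by have [] := PP i (ltn_ord i).
have nonadj (u : G) : \sum_v ~~ edge v u = #|G| - #|neighbours u|.
  rewrite -(cardsC (neighbours u)) addKn -sum1_card [RHS]big_mkcond /=.
  by apply: eq_bigr => v _; rewrite !inE edge_sym; case: edge.
have badE : b * (#|~: good| * (T - t)) <= j * T * a * #|G|.
  apply: leq_trans (_ : b * \sum_(v : G) \sum_(i < j) \sum_(u in P i) ~~ edge v u <= _).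
    rewrite leq_mul2l -sum_nat_const big_mkcond /=; apply/orP; right.
    apply: leq_sum => v _; rewrite !inE; case: ifP => // /forallPn [i].
    rewrite -ltnNge => lt; rewrite (bigD1 i) //=; apply: leq_trans (leq_addr _ _).
    have [_ cP] := PP i (ltn_ord i).
    have := cardsID (neighbours v) (P i); rewrite cP -/T => E.
    have -> : \sum_(u in P i) ~~ edge v u = #|P i :\: neighbours v|.
      rewrite -sum1_card big_mkcond /= [RHS]big_mkcond /=.
      by apply: eq_bigr => u _; rewrite !inE; case: (edge v u); case: (u \in P i).
    by lia.
  rewrite exchange_big big_distrr /=.
  have -> : j * T * a * #|G| = \sum_(i < j) T * (a * #|G|).
    by rewrite sum_nat_const card_ord; lia.
  apply: leq_sum => i _; rewrite exchange_big big_distrr /=.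
  have [_ cP] := PP i (ltn_ord i).
  rewrite -/T in cP; rewrite -cP -sum_nat_const; apply: leq_sum => u _.
  by rewrite nonadj.
(* As [T - t = (2 * b - 1) * t] and [j * a <= b - 1], [badE] leaves at most a fraction (2b - 2)/(2b
   - 1) of the vertices bad. *)
have goodE : #|G| <= (2 * b - 1) * #|good|.
  have b0 : 0 < b by lia.
  have ETt : T - t = (2 * b - 1) * t by rewrite mulnBl mul1n.
  have : (b * t) * ((2 * b - 1) * #|~: good|) <= (b * t) * (2 * (j * a) * #|G|).
    by move: badE; rewrite ETt /T; congr (_ <= _); ring.
  rewrite leq_pmul2l ?muln_gt0 ?b0 // => le1.
  have le2 : j * a * #|G| <= (b - 1) * #|G| by rewrite leq_mul2r; lia.
  have := cardsC good; move: le1 le2; move: #|good| #|~: good| #|G| => x y n.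
  have [b' ->] : exists b', b = b'.+1 by exists b.-1; lia.
  by nia.
pose pat (v : G) : {set G} := (neighbours v :&: X)%SET.
have [||c ct] := @pigeonhole _ _ pat good (powerset X) t.-1.
- by move=> v _; rewrite powersetE subsetIr.
- rewrite card_powerset.
  have le1 : 2 ^ #|X| * t.-1 <= 2 ^ (j * T) * t.-1 by rewrite leq_mul2r leq_exp2l ?XT ?orbT.
  apply: leq_ltn_trans le1 _.
  have e0 : 0 < 2 ^ (j * T) by rewrite expn_gt0.
  have : 2 * b * (2 ^ (j * T) * t) <= 2 * b * #|good|.
    by apply: leq_trans nbig (leq_trans goodE _); rewrite leq_mul2r leq_subr orbT.
  rewrite leq_pmul2l; last by lia.
  by apply: leq_trans; rewrite ltn_pmul2l // ltn_predL.
have ct' : t <= #|[set i in good | pat i == c]%SET| by rewrite -(prednK t0).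
have cP i : i < j -> t <= #|P i :&: c|.
  move=> ij; have /card_gt0P [v] := leq_trans t0 ct'.
  rewrite !inE => /andP [/forallP /(_ (Ordinal ij)) /= h /eqP <-].
  apply: leq_trans h _; apply: subset_leq_card; apply/subsetP => u.
  rewrite !inE => /andP [uP ->]; rewrite uP /=.
  by apply/bigcupP; exists (Ordinal ij).
(* The old parts are cut down to the common trace [c], and the vertices with this trace form the new
   part. *)
exists (fun i => if i < j then P i :&: c else [set i in good | pat i == c])%SET.
split=> [i ij|i i' u v ij ij' ii'].
  by case: ifP => [/cP//|_].
have key i0 w z : i0 < j -> w \in (P i0 :&: c)%SET ->
    z \in [set i in good | pat i == c]%SET -> edge w z.
  move=> ij0; rewrite !inE => /andP [_ wc] /andP [_ /eqP ez].
  by move: wc; rewrite -ez !inE edge_sym => /andP [].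
case: ifP => [lij|nij]; case: ifP => [lij'|nij'].
- by rewrite !inE => /andP [uP _] /andP [vP _]; apply: Pe uP vP.
- exact: key lij.
- by move=> uc vP; rewrite edge_sym; apply: key lij' vP uc.
- by lia.
Qed.

(** The integers [a], [b] encode a minimum degree of at least (1 - a/b)n, where 1 - a/b > q/(q + 1).
    Parts are added one at a time, with [t.+1] in place of [t] to keep sizes positive. *)
Lemma erdos_stone_min_degree (q a b : nat) : q.+1 * a < b -> forall j t, j <= q.+2 ->
  exists n0, forall G : sgraph, n0 <= #|G| ->
    (forall v : G, b * (#|G| - #|neighbours v|) <= a * #|G|) ->
    complete_multipartite_in G j t.
Proof.
move=> qab; elim=> [|j IHj] t jq.
  by exists 0 => G _ _; exists (fun=> set0).
have [n0 n0P] := IHj (2 * b * t.+1) (ltnW jq).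
exists (maxn n0 (2 * b * (2 ^ (j * (2 * b * t.+1)) * t.+1))) => G.
rewrite geq_max => /andP [Gn0 Gbig] deg.
have [P [Pt Pe]] : complete_multipartite_in G j.+1 t.+1.
  apply: (@multipartite_step G a b) => //; last exact: n0P.
  by apply: leq_ltn_trans qab; rewrite leq_mul2r -ltnS jq orbT.
by exists P; split=> // i ij; apply: ltnW (Pt _ ij).
Qed.

(** * Homomorphisms and minimal non-bipartite sets *)

Definition hom_on (H L : sgraph) (U : {set H}) (f : H -> L) : Prop :=
  {in U &, forall u v, edge u v -> edge (f u) (f v)}.

Section Bipartite.
Variable H : sgraph.

Definition bipartite_on (W : {set H}) : Prop :=
  exists f : H -> bool, {in W &, forall u v, edge u v -> f u != f v}.

(** The colouring of [D] is flipped, if necessary, so that the only possible crossing edge [yx] gets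
    two colours. *)
Lemma bipartite_on_glue (W D : {set H}) (x y : H) : D \subset W ->
  bipartite_on D -> bipartite_on (W :\: D) ->
  (forall u v, u \in D -> v \in W :\: D -> edge u v -> u = y /\ v = x) ->
  bipartite_on W.
Proof.
move=> sD [fD fDP] [fE fEP] cross.
exists (fun c => if c \in D then fD c (+) (fD y == fE x) else fE c) => u v uW vW uv.
have crossP w z : w \in D -> z \in W -> z \notin D -> edge w z ->
    fD w (+) (fD y == fE x) != fE z.
  move=> wD zW zD wz; have [|-> ->] := cross w z wD _ wz; first by rewrite inE zD.
  by case: (fD y); case: (fE x).
case: ifP => uD; case: ifP => vD.
- by rewrite (inj_eq (can_inj (addbK _))) fDP.
- by apply: crossP; rewrite ?vD.
- by rewrite eq_sym; apply: crossP; rewrite ?uD // edge_sym.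
- by apply: fEP => //; rewrite inE ?uD ?vD.
Qed.

(** These are the vertex sets of induced odd cycles, described by the minimality that the gluing
    arguments use. *)
Definition odd_critical (W : {set H}) : Prop :=
  ~ bipartite_on W /\ forall D : {set H}, D \proper W -> bipartite_on D.

Lemma exists_odd_critical (K : {set H}) : ~ bipartite_on K ->
  exists2 W : {set H}, W \subset K & odd_critical W.
Proof.
move=> nbK; have [n] := ubnP #|K|; elim: n => // n IHn in K nbK *; rewrite ltnS => leK.
have [crit|] := pselect (forall D : {set H}, D \proper K -> bipartite_on D).
  by exists K.
move=> /existsNP [D /not_implyP [DK nbD]].
have [|W WD Wc] := IHn _ nbD; first exact: leq_trans (proper_card DK) leK.
by exists W => //; apply: subset_trans WD (proper_sub DK).
Qed.

Lemma odd_critical_nonempty (W : {set H}) : odd_critical W -> exists x, x \in W.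
Proof.
move=> [nb _]; apply/set0Pn; apply/eqP => W0; apply: nb; rewrite W0.
by exists (fun=> true) => u v; rewrite inE.
Qed.

(** Otherwise [W] is glued from [[set v]] and the rest along at most one edge. *)
Lemma odd_critical_deg2 (W : {set H}) (v : H) : odd_critical W -> v \in W ->
  exists u1 u2, [/\ u1 \in W, u2 \in W, u1 != u2, edge v u1 & edge v u2].
Proof.
move=> [nb crit] vW; apply: contrapT => no2.
have uniqP u1 u2 : u1 \in W -> u2 \in W -> edge v u1 -> edge v u2 -> u1 = u2.
  move=> u1W u2W e1 e2; apply/eqP; apply: contraT => ne.
  by case: no2; exists u1, u2.
have bv : bipartite_on [set v].
  by exists (fun=> true) => a b; rewrite !inE => /eqP -> /eqP ->; rewrite edge_irrefl.
have bE : bipartite_on (W :\: [set v]) by apply: crit; apply: properD1.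
have sv : [set v] \subset W by rewrite sub1set.
have [u /andP [uW vu]|none] := pickP (fun u => (u \in W) && edge v u).
  apply: nb; apply: (bipartite_on_glue (x := u) (y := v) sv bv bE) => a b.
  rewrite !inE => /eqP -> /andP [_ bW] e; split=> //; exact: uniqP.
apply: nb; apply: (bipartite_on_glue (x := v) (y := v) sv bv bE) => a b.
by rewrite !inE => /eqP -> /andP [_ bW] e; have := none b; rewrite bW e.
Qed.

End Bipartite.

(** * A minimal target that is a core *)

Section MinimalTarget.
Variables (H : sgraph) (q : nat).

(* Equivalently, [H] maps to the join of [H[U]] with a complete graph on [q] vertices. *)
Definition cocolorable (U : {set H}) : Prop :=
  exists c : H -> nat, forall u, u \notin U -> c u < q /\
    forall v, v \notin U -> edge u v -> c u != c v.

Definition set_hom (K K' : {set H}) : Prop :=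
  exists2 f : H -> H, hom_on K f & forall u, u \in K -> f u \in K'.

Lemma set_hom_sub (K K' : {set H}) : K \subset K' -> set_hom K K'.
Proof. by move/subsetP => s; exists id => // u v. Qed.

Lemma set_hom_trans (K1 K2 K3 : {set H}) : set_hom K1 K2 -> set_hom K2 K3 -> set_hom K1 K3.
Proof.
move=> [f fe fK] [g ge gK]; exists (g \o f) => [u v uK vK e|u uK] /=; last exact/gK/fK.
by apply: ge; rewrite ?fK //; apply: fe.
Qed.

(** Equivalently, [H] maps to the join of [H[K]] with a complete graph on [q] vertices. Taking [K]
    inside [H] leaves finitely many candidates. *)
Definition target (K : {set H}) : Prop :=
  exists2 U : {set H}, cocolorable U & set_hom U K.

Lemma exists_minimal_target : exists K : {set H},
  [/\ target K,
      forall U, cocolorable U -> set_hom U K -> set_hom K U &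
      forall f : H -> H, hom_on K f -> (forall u, u \in K -> f u \in K) -> f @: K = K].
Proof.
pose down (K : {set H}) := [set K' : {set H} | `[< target K' /\ set_hom K' K >]].
(* Lexicographic: first as low as possible in the homomorphism order, then of least size. *)
pose mu (K : {set H}) := #|down K| * #|H|.+1 + #|K|.
have targetT : target [set: H].
  by exists [set: H]; [exists (fun=> 0) => u; rewrite inE | apply: set_hom_sub].
have [K tK Kmin] : exists2 K, target K & forall K', target K' -> mu K <= mu K'.
  have h0 : `[< target [set: H] >] by apply/asboolP.
  have [K /asboolP tK Kmin] :=
    @arg_minnP _ [set: H] (fun K => `[< target K >]) mu h0; exists K => // K' tK'.
  by apply: Kmin; apply/asboolP.
have downS K1 K2 : set_hom K1 K2 -> down K1 \subset down K2.
  move=> h; apply/subsetP => K'; rewrite !inE => /asboolP [t' h'].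
  by apply/asboolP; split=> //; apply: set_hom_trans h.
exists K; split=> // [U cU hU|f fe fK].
  have tU : target U by exists U => //; apply: set_hom_sub.
  have := Kmin _ tU; rewrite /mu => le.
  have: K \in down U.
    apply: contraLR le => nK; rewrite -ltnNge.
    have pr : down U \proper down K.
      apply/properP; split; first exact: downS.
      by exists K => //; rewrite inE; apply/asboolP; split=> //; apply: set_hom_sub.
    have leU : #|U| <= #|H| := max_card _.
    have : (#|down U|).+1 * #|H|.+1 <= #|down K| * #|H|.+1.
      by rewrite leq_mul2r proper_card // orbT.
    by rewrite mulSn; lia.
  by rewrite inE => /asboolP [].
have sub : f @: K \subset K by apply/subsetP => _ /imsetP [u uK ->]; apply: fK.
have tf : target (f @: K).
  have [U cU hU] := tK; exists U => //; apply: set_hom_trans hU _.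
  by exists f => // u uK; apply: imset_f.
apply/eqP; rewrite eqEcard sub /=.
have := Kmin _ tf; rewrite /mu.
have : #|down (f @: K)| * #|H|.+1 <= #|down K| * #|H|.+1.
  by rewrite leq_mul2r subset_leq_card ?orbT // downS //; apply: set_hom_sub.
by lia.
Qed.

(** A 2-colouring of [K], pulled back to [U], would add only the colours [q] and [q + 1] to those
    used off [U]. *)
Lemma target_not_bipartite (K : {set H}) :
  ~~ colorable H q.+2 -> target K -> ~ bipartite_on K.
Proof.
move=> /negP nc [U [c cP] [g ge gK]] [f fP]; apply: nc; apply/existsP.
pose d u := if u \in U then q + f (g u) else c u.
have dlt u : d u < q.+2.
  rewrite /d; case: ifP => uU; first by case: (f _); lia.
  by have [|] := cP u; rewrite ?uU //; lia.
exists [ffun u => Ordinal (dlt u)]; apply/forallP => u; apply/forallP => v.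
apply/implyP => uv; rewrite !ffunE; apply/negP => /eqP [].
rewrite /d; case: ifPn => uU; case: ifPn => vU.
- move/addnI => e; have := fP _ _ (gK _ uU) (gK _ vU) (ge _ _ uU vU uv).
  by case: (f _) e; case: (f _).
- by have [] := cP _ vU; lia.
- by have [] := cP _ uU; lia.
- by have [_ /(_ _ vU uv) /eqP] := cP _ uU.
Qed.

End MinimalTarget.

(** Extended by the identity off [K], [f] is a permutation, and its order serves as exponent. Being
    positive, the exponent lets one factor be split off to form a section. *)
Lemma surjective_iter_id (T : finType) (K : {set T}) (f : T -> T) :
  f @: K = K -> exists n, {in K, forall c, iter n.+1 f c = c}.
Proof.
move=> fK; have fI : {in K &, injective f} by apply/imset_injP; rewrite fK.
have fin c : c \in K -> f c \in K by move=> cK; rewrite -fK imset_f.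
pose g c := if c \in K then f c else c.
have gI : injective g.
  move=> c d; rewrite /g; case: ifPn => cK; case: ifPn => dK //.
  - exact: fI.
  - by move=> e; have := fin _ cK; rewrite e (negPf dK).
  - by move=> e; have := fin _ dK; rewrite -e (negPf cK).
have iterE n c : c \in K -> iter n f c = iter n g c /\ iter n f c \in K.
  by move=> cK; elim: n => // n [/= <- iK]; rewrite /g iK fin.
exists #[perm gI]%g.-1 => c cK; rewrite prednK ?order_gt0 //.
have [-> _] := @iterE #[perm gI]%g c cK.
have := permX (perm gI) c #[perm gI]%g; rewrite expg_order perm1 => e; rewrite [RHS]e.
by apply: eq_iter => d; rewrite permE.
Qed.

(** * The gadget and its [H]-freeness *)

Section Gadget.
Variables (H : sgraph) (q m N : nat) (K : {set H}) (x y : H).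

(** All classes have the same size. An extra part consists of [2 * #|H| - 1] classes, the most that
    a core vertex can miss, which balances the degrees. *)
Definition gadget_vertex : finType :=
  (((bool * H) + ('I_q * 'I_(2 * #|H| - 1))) * ({set 'I_m} * 'I_m * 'I_N))%type.

Definition kedge : rel H := fun c c' => [&& c \in K, c' \in K & edge c c'].

Lemma kedge_sym : symmetric kedge.
Proof. by move=> c c'; rewrite /kedge edge_sym andbCA. Qed.

(* [inl (true, c)] with index [(A, i, k)] is a vertex of class [c]; [inl (false, c)]
   is joined to all of class [c] and serves only to make degrees linear; the [inr]
   classes are the [q] extra parts of the join.  Only [A] matters in class [x] and
   only [i] elsewhere: [A] sees copy [i] of [y] iff [i \in A], and copy [i] of the
   other neighbours of [x] iff [i \notin A].  So for [i \notin A], joining [A] to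
   copy [i] of [y] completes a copy of [K]. *)
Definition gadget_rel : rel gadget_vertex := fun p p' =>
  match p.1, p'.1 with
  | inl (true, c), inl (true, c') => kedge c c' &&
      (if c == x then (c' == y) == (p'.2.1.2 \in p.2.1.1)
       else if c' == x then (c == y) == (p.2.1.2 \in p'.2.1.1)
       else p.2.1.2 == p'.2.1.2)
  | inl (b, c), inl (b', c') => (b != b') && (c == c')
  | inr (j, _), inr (j', _) => j != j'
  | _, _ => true
  end.

Lemma gadget_sym : symmetric gadget_rel.
Proof.
move=> [[[[] c]|[j z]] [[A i] k]] [[[[] c']|[j' z']] [[A' i'] k']];
  rewrite /gadget_rel //= 1?eq_sym //.
rewrite kedge_sym; have [->|_] := eqVneq c x; have [->|_] := eqVneq c' x => //.
  by rewrite /kedge edge_irrefl !andbF.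
by congr (_ && _); apply: eq_sym.
Qed.

Lemma gadget_irrefl : irreflexive gadget_rel.
Proof.
move=> [[[[] c]|[j z]] [[A i] k]]; rewrite /gadget_rel //= ?eqxx //.
by rewrite /kedge edge_irrefl !andbF.
Qed.

Definition gadget : sgraph := SGraph gadget_sym gadget_irrefl.

Definition is_core (p : gadget) : bool := if p.1 is inl _ then true else false.

(** The class [(false, c)] goes to a neighbour of [c] in [K]. If there is none, [(true, c)] and
    [(false, c)] see only each other in the core and go to the edge [xy]. *)
Definition gadget_proj (p : gadget) : H :=
  match p.1 with
  | inl (b, c) => if [pick c' | kedge c c'] is Some c' then if b then c else c'
                  else if b then x else y
  | inr _ => x
  end.

Hypotheses (xK : x \in K) (yK : y \in K) (xy : edge x y).

Lemma gadget_proj_in (p : gadget) : gadget_proj p \in K.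
Proof.
case: p => [[[b c]|[j z]] w]; rewrite /gadget_proj //=.
case: pickP => [c' /and3P [cK cK' _]|_]; by case: b.
Qed.

Lemma gadget_proj_edge (p p' : gadget) : is_core p -> is_core p' ->
  edge p p' -> edge (gadget_proj p) (gadget_proj p').
Proof.
case: p => [[[b c]|[j z]] w] //; case: p' => [[[b' c']|[j' z']] w'] // _ _.
rewrite /gadget_proj /= /gadget_rel /=.
have same (d : H) : edge (if [pick c' | kedge d c'] is Some c' then d else x)
    (if [pick c' | kedge d c'] is Some c' then c' else y).
  by case: pickP => [d' /and3P []|].
case: b; case: b' => //=.
- case/andP => kc _; case: pickP => [_ _|/(_ c')]; last by rewrite kc.
  case: pickP => [_ _|/(_ c)]; last by rewrite kedge_sym kc.
  by case/and3P: kc.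
- by move/eqP <-; apply: same.
- by move/eqP ->; rewrite edge_sym; apply: same.
Qed.

Variable W : {set H}.
Hypotheses (WK : W \subset K) (Wcrit : odd_critical W) (xW : x \in W) (yW : y \in W).

(* For a section [s], the vertices of [W] other than [x] whose index lies in the
   index [A] of [s x] are joined to the rest of [W] by the edge [xy] only, so
   2-colourings of the two sides glue. *)
Lemma gadget_no_section (s : H -> gadget) :
  hom_on K s -> (forall c, c \in K -> is_core (s c)) ->
  (forall c, c \in K -> gadget_proj (s c) = c) -> False.
Proof.
move=> se sc sp; have inK c : c \in W -> c \in K by apply/(subsetP WK).
pose ix c := (s c).2.1.2; pose A := (s x).2.1.1.
(* In the core, class [(false, d)] sees only [(true, d)], so there two distinct neighbours of [c]
   would have equal projections; likewise if [d] has no neighbour in [K]. *)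
have shape c : c \in W -> (s c).1 = inl (true, c).
  move=> cW; have [u1 [u2 [u1W u2W u12 e1 e2]]] := odd_critical_deg2 Wcrit cW.
  have := sp _ (inK _ cW); have := sc _ (inK _ cW).
  have := se _ _ (inK _ cW) (inK _ u1W) e1; have := se _ _ (inK _ cW) (inK _ u2W) e2.
  have := sp _ (inK _ u1W); have := sp _ (inK _ u2W).
  have := sc _ (inK _ u1W); have := sc _ (inK _ u2W).
  case: (s c) => [[[b d]|//] w]; case: (s u1) => [[[b1 d1]|//] w1].
  case: (s u2) => [[[b2 d2]|//] w2] _ _ p2 p1 E2 E1 _ pc.
  have nb : b.
    move: b E1 E2 {pc} => [] //; case: b1 p1 => //; case: b2 p2 => //.
    move=> p2 p1 /= /eqP e /eqP e'; case/eqP: u12.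
    by rewrite -p1 -p2 /gadget_proj /= -e -e'.
  case: b nb pc E1 E2 => // _; rewrite {1}/gadget_proj /=.
  case: pickP => [_ _ -> //|none _].
  rewrite /gadget_rel /=; case: b1 p1 => [p1|p1]; first by rewrite none.
  case: b2 p2 => [p2|p2]; first by rewrite none.
  move=> /= /eqP e /eqP e'; case/eqP: u12.
  by rewrite -p1 -p2 /gadget_proj /= -e -e'.
have adj c c' : c \in W -> c' \in W -> edge c c' -> c' != x ->
    if c == x then (c' == y) = (ix c' \in A) else ix c = ix c'.
  move=> cW cW' e c'x; have := se _ _ (inK _ cW) (inK _ cW') e.
  rewrite /= /gadget_rel !shape //= (negPf c'x) => /andP [_].
  by rewrite /ix /A; case: eqP => [->|_] /eqP.
pose D := [set c in W | (c != x) && (ix c \in A)].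
have sD : D \subset W by apply/subsetP => c; rewrite inE => /andP [].
have yD : y \in D.
  have yx : y != x by rewrite eq_sym edge_neq.
  by have := adj x y xW yW xy yx; rewrite !inE yW yx !eqxx /= => <-.
have [nb crit] := Wcrit; apply: nb.
apply: (bipartite_on_glue (D := D) (x := x) (y := y)) => //.
- by apply: crit; apply/properP; split=> //; exists x; rewrite // !inE eqxx /= andbF.
- apply: crit; apply/properP; split; first exact: subsetDl.
  by exists y; rewrite // inE yD.
move=> u v; rewrite [v \in _ :\: _]inE => uD /andP [vD vW] e.
move: (uD); rewrite inE => /and3P [uW ux uA].
have [vx|vx] := eqVneq v x.
  split=> //; apply/eqP; have := adj x u xW uW _ ux.
  by rewrite eqxx edge_sym -vx e uA => ->.
have := adj u v uW vW e vx; rewrite (negPf ux) => eix.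
by move: vD; rewrite inE vW vx -eix uA.
Qed.

Hypothesis Kmin : forall U : {set H}, cocolorable q U -> set_hom U K -> set_hom K U.
Hypothesis Kcore : forall f : H -> H,
  hom_on K f -> (forall u, u \in K -> f u \in K) -> f @: K = K.

(* A copy of [H] yields a homomorphism from [K] by minimality; composing it with a
   power of the induced automorphism of the core [K] turns it into a section. *)
Lemma gadget_free : copy_free H gadget.
Proof.
move=> [f _ fe]; pose U := [set u | is_core (f u)].
have cU : cocolorable q U.
  exists (fun u => if (f u).1 is inr (j, _) then nat_of_ord j else 0) => u.
  rewrite inE /is_core; case Eu: (f u).1 => [//|[j z]] _; split=> // v.
  rewrite inE /is_core; case Ev: (f v).1 => [//|[j' z']] _ /fe.
  by rewrite /= /gadget_rel Eu Ev.
have hU : set_hom U K.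
  exists (gadget_proj \o f) => [u v|u _]; last exact: gadget_proj_in.
  by rewrite !inE => uc vc /fe; apply: gadget_proj_edge.
have [g ge gU] := Kmin cU hU.
pose e := gadget_proj \o (f \o g).
have he : hom_on K e.
  move=> u v uK vK uv; apply: gadget_proj_edge; last by apply/fe/ge.
    by have := gU _ uK; rewrite inE.
  by have := gU _ vK; rewrite inE.
have eK u : u \in K -> e u \in K by move=> _; apply: gadget_proj_in.
have [n nP] := surjective_iter_id (Kcore he eK).
have iK k u : u \in K -> iter k e u \in K by move=> uK; elim: k => //= k; apply: eK.
have ie k : hom_on K (iter k e).
  by move=> u v uK vK uv; elim: k => //= k; apply: he; apply: iK.
apply: (@gadget_no_section (f \o g \o iter n e)) => [u v uK vK uv|c cK|c cK].
- by apply/fe/ge; rewrite ?iK //; apply: ie.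
- by have := gU _ (iK n _ cK); rewrite inE.
- exact: nP.
Qed.

End Gadget.

(** * Maximal extensions of the gadget *)

Lemma exists_injection_into (S T : finType) (B : {set T}) : #|S| <= #|B| ->
  exists2 f : S -> T, injective f & forall s, f s \in B.
Proof.
move=> SB; exists (fun s => enum_val (widen_ord SB (enum_rank s))).
  by move=> s t /enum_val_inj [/ord_inj/enum_rank_inj].
by move=> s; apply: enum_valP.
Qed.

Section GadgetExtension.
Variables (H : sgraph) (q m N : nat) (K : {set H}) (x y : H).
Let Gamma := gadget q m N K x y.
Variables (e : rel Gamma) (es : symmetric e) (ei : irreflexive e).
Let G := SGraph es ei.
Hypothesis e_sub : subrel (edge (s := Gamma)) e.
Hypotheses (xK : x \in K) (yK : y \in K) (xy : edge x y).

Lemma card_gadget : #|G| = ((2 * #|H| - 1) * q.+1 + 1) * #|{: {set 'I_m} * 'I_m * 'I_N}|.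
Proof.
have h0 : 0 < #|H| by apply/card_gt0P; exists x.
rewrite card_prod card_sum !card_prod card_bool !card_ord.
by congr (_ * _); lia.
Qed.

(** In the core a vertex of class [(b, c)] is sure to see class [(~~ b, c)], and a vertex of an
    extra part misses only that part. Either way at most [2 * #|H| - 1] classes are missed. *)
Lemma gadget_min_degree :
  ((2 * #|H| - 1) * q + 1) * #|G| <= ((2 * #|H| - 1) * q.+1 + 1) * min_degree G.
Proof.
have h0 : 0 < #|H| by apply/card_gt0P; exists x.
rewrite card_gadget mulnCA leq_mul2l; apply/orP; right.
set L := #|{: {set 'I_m} * 'I_m * 'I_N}|.
apply: le_min_degree => [|v].
  by rewrite card_gadget -/L leq_mul2r mulnS; apply/orP; right; lia.
pose F : finType := ((bool * H) + ('I_q * 'I_(2 * #|H| - 1)))%type.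
have [S cS SP] : exists2 S : {set F}, #|S| <= 2 * #|H| - 1 &
    forall p : G, p.1 \notin S -> edge (s := Gamma) v p.
  case: v => [[[b c]|[j z]] w].
    exists (inl @: [set~ (~~ b, c)]).
      apply: leq_trans (leq_imset_card _ _) _.
      by rewrite cardsC1 card_prod card_bool; lia.
    move=> [[[b' c']|[j' z']] w'] nS; last by case: b {nS}.
    have : (b', c') = (~~ b, c).
      by apply/eqP; apply: contraNT nS => ne; apply: imset_f; rewrite !inE.
    by case=> -> ->; rewrite /= /gadget_rel /=; case: b {nS}; rewrite /= eqxx.
  exists ((fun z' => inr (j, z')) @: [set: 'I_(2 * #|H| - 1)]).
    by apply: leq_trans (leq_imset_card _ _) _; rewrite cardsT card_ord.
  move=> [[[b' c']|[j' z']] w'] nS; first by [].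
  rewrite /= /gadget_rel /=; apply: contraNneq nS => <-.
  by apply: imset_f; rewrite inE.
apply: leq_trans (_ : #|setX (~: S) [set: {set 'I_m} * 'I_m * 'I_N]| <= _).
  rewrite cardsX cardsT -/L leq_mul2r; apply/orP; right.
  have := cardsC S; rewrite card_sum !card_prod card_bool !card_ord.
  have : (2 * #|H| - 1) * q = q * (2 * #|H| - 1) by rewrite mulnC.
  by lia.
apply: subset_leq_card; apply/subsetP => p.
by rewrite !inE andbT => pS; apply: e_sub; apply: SP.
Qed.

Variable i0 : 'I_m.

Definition xcopy (A : {set 'I_m}) (k : 'I_N) : G := (inl (true, x), (A, i0, k)).
Definition ycopy (i : 'I_m) (k : 'I_N) : G := (inl (true, y), (set0, i, k)).

Variable U : {set H}.
Hypotheses (cU : cocolorable q U) (hU : set_hom U K).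

(** The set [U] is sent to the core along [g], and the rest to the extra parts by its colours. Since
    [i \notin A], all edges exist in the gadget except those between classes [x] and [y], which
    [full] supplies. *)
Lemma gadget_copy (A : {set 'I_m}) (i : 'I_m) (ks ls : H -> 'I_N) : #|H| <= N ->
  i \notin A -> injective ks -> injective ls ->
  (forall u v, edge (xcopy A (ks u)) (ycopy i (ls v))) -> contains_copy H G.
Proof.
move=> HN iA ksI lsI full.
have h0 : 0 < #|H| by apply/card_gt0P; exists x.
have [g ge gK] := hU; have [c cP] := cU.
pose F : finType := ((bool * H) + ('I_q * 'I_(2 * #|H| - 1)))%type.
have [d dP] : {d : H -> F & forall v, v \notin U ->
    exists j z, d v = inr (j, z) /\ nat_of_ord j = c v}.
  apply: (choice (P := fun v (a : F) => v \notin U ->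
    exists j z, a = inr (j, z) /\ nat_of_ord j = c v)) => v.
  have [vU|vU] := boolP (v \in U); first by exists (inl (true, x)).
  have [lt _] := cP _ vU; have z0 : 0 < 2 * #|H| - 1 by lia.
  by exists (inr (Ordinal lt, Ordinal z0)) => _; exists (Ordinal lt), (Ordinal z0).
pose r (v : H) : 'I_N := widen_ord HN (enum_rank v).
have rI : injective r by move=> u v [/ord_inj/enum_rank_inj].
pose place (a : H) : H -> 'I_N := if a == x then ks else if a == y then ls else r.
have placeI a : injective (place a) by rewrite /place; do 2?case: ifP.
(* The irrelevant coordinates [i0] and [set0] agree with [xcopy] and [ycopy]. *)
pose lab (a : H) := if a == x then (A, i0) else if a == y then (set0, i) else (A, i).
pose f (v : H) : G :=
  if v \in U then (inl (true, g v), (lab (g v), place (g v) v)) else (d v, ((A, i), r v)).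
have fU u v : u \in U -> v \in U -> g u != x -> edge u v -> e (f v) (f u).
  move=> uU vU gux uv; rewrite /f uU vU.
  have kuv : kedge K (g v) (g u).
    by rewrite /kedge !gK //= ge // edge_sym.
  have [gvx|gvx] := eqVneq (g v) x; last first.
    apply: e_sub; rewrite /= /gadget_rel /= kuv /= (negPf gvx) (negPf gux).
    by rewrite /lab (negPf gvx) (negPf gux); case: ifP; case: ifP.
  rewrite gvx /lab /place eqxx (negPf gux).
  have [guy|guy] := eqVneq (g u) y; first by rewrite guy; apply: full.
  apply: e_sub; rewrite /= /gadget_rel /= -gvx kuv /= gvx eqxx (negPf guy).
  by rewrite (negPf iA).
have fx u v : u \in U -> v \notin U -> e (f u) (f v).
  move=> uU vU; have [j [z [dv _]]] := dP _ vU.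
  by apply: e_sub; rewrite /f uU (negPf vU) /= /gadget_rel /= dv.
exists f => [u v|u v uv].
  rewrite /f; case: ifPn => uU; case: ifPn => vU.
  - by case=> <- _ /placeI.
  - by have [j [z [-> _]]] := dP _ vU.
  - by have [j [z [-> _]]] := dP _ uU.
  - by move=> /(congr1 (fun p : Gamma => p.2.2)) /= /rI.
rewrite /=; have [uU|uU] := boolP (u \in U); have [vU|vU] := boolP (v \in U).
- have [gux|gux] := eqVneq (g u) x; last by rewrite es; apply: fU.
  apply: fU; rewrite // 1?edge_sym //; apply: contraTneq (ge _ _ uU vU uv) => gvx.
  by rewrite gux gvx edge_irrefl.
- exact: fx.
- by rewrite es; apply: fx.
- have [j [z [du ju]]] := dP _ uU; have [j' [z' [dv jv]]] := dP _ vU.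
  apply: e_sub; rewrite /f (negPf uU) (negPf vU) /= /gadget_rel /= du dv.
  have [_ /(_ _ vU uv)] := cP _ uU; rewrite -ju -jv.
  by apply: contraNneq => ->.
Qed.

Hypothesis Gfree : copy_free H G.

Let w := (#|{: {set 'I_m} * 'I_m}| * #|H|).+1.

(* [#|H|] of the [N] columns see the first [w] columns in the same way; a column
   [l] among these [w] outside all the [bad] sets is then seen by them exactly as in
   the gadget, since a [bad] set with [#|H|] elements would give a copy of [H]. *)
Lemma gadget_VC :
  #|{: {ffun {set 'I_m} * 'I_m * 'I_w -> bool}}| * #|H| < N -> w <= N -> m <= VC G.
Proof.
move=> Nbig wN.
have HN : #|H| <= N.
  have : 0 < #|{: {set 'I_m} * 'I_m}| by apply/card_gt0P; exists (set0, i0).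
  by move: wN; rewrite /w; nia.
pose wid : 'I_w -> 'I_N := widen_ord wN.
have widI : injective wid by move=> k l [/ord_inj].
pose pat (k : 'I_N) : {ffun {set 'I_m} * 'I_m * 'I_w -> bool} :=
  [ffun p => e (xcopy p.1.1 k) (ycopy p.1.2 (wid p.2))].
have [||c cH] := @pigeonhole _ _ pat [set: 'I_N] [set: {ffun {set 'I_m} * 'I_m * 'I_w -> bool}] #|H|.
- by move=> *; rewrite inE.
- by rewrite !cardsT card_ord.
set Kc := [set k in [set: 'I_N] | pat k == c] in cH.
have cE k A i l : k \in Kc -> c (A, i, l) = e (xcopy A k) (ycopy i (wid l)).
  by rewrite !inE /= => /eqP <-; rewrite ffunE.
pose bad (p : {set 'I_m} * 'I_m) : {set 'I_w} :=
  if p.2 \in p.1 then set0 else [set l | c (p, l)].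
have badH p : #|bad p| <= #|H|.
  rewrite /bad; case: ifPn => pA; first by rewrite cards0.
  rewrite leqNgt; apply/negP => lt; apply: Gfree.
  have [ks ksI ksP] := exists_injection_into (ltnW cH).
  have [ls lsI lsP] := exists_injection_into (ltnW lt).
  apply: (@gadget_copy p.1 p.2 ks (wid \o ls)) => //; first exact: inj_comp.
  move=> u v; have := lsP v; rewrite inE (surjective_pairing p) (cE (ks u)) //.
have [l lP] : exists l, l \notin \bigcup_p bad p.
  apply/existsP; apply: contraT; rewrite negb_exists => /forallP all.
  have : #|[set: 'I_w]| <= \sum_p #|bad p|.
    apply: leq_trans (_ : #|\bigcup_p bad p| <= _).
      by apply: subset_leq_card; apply/subsetP => l _; have := all l; rewrite negbK.
    elim/big_rec2: _ => [|p B n _ IH]; first by rewrite cards0.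
    by apply: leq_trans (leq_card_setU _ _) _; rewrite leq_add2l.
  rewrite cardsT card_ord leqNgt; case/negP; rewrite ltnS -sum_nat_const.
  by apply: leq_sum => p _.
have /card_gt0P [k kKc] := leq_ltn_trans (leq0n _) cH.
apply: (@shatter_le_VC G m (xcopy^~ k) (ycopy^~ (wid l))) => A i.
have [iA|iA] := boolP (i \in A).
  by apply: e_sub; rewrite /= /gadget_rel /= /kedge xK yK xy !eqxx iA.
have := lP; apply: contraNF => /= adj; apply/bigcupP; exists (A, i) => //.
by rewrite /bad /= (negPf iA) inE (cE k).
Qed.

End GadgetExtension.

Lemma large_VC_maximal_free (H : sgraph) (q C : nat) : ~~ colorable H q.+2 ->
  exists G : sgraph, [/\ maximal_copy_free H G,
    ((2 * #|H| - 1) * q + 1) * #|G| <= ((2 * #|H| - 1) * q.+1 + 1) * min_degree G,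
    0 < #|G| & C < VC G].
Proof.
move=> ncol; have [K [tK Kmin Kcore]] := exists_minimal_target H q.
have [W WK Wcrit] := exists_odd_critical (target_not_bipartite ncol tK).
have [x xW] := odd_critical_nonempty Wcrit.
have [y [_ [yW _ _ xy _]]] := odd_critical_deg2 Wcrit xW.
have xK := subsetP WK _ xW; have yK := subsetP WK _ yW.
pose w := (#|{: {set 'I_C.+1} * 'I_C.+1}| * #|H|).+1.
pose N := (#|{: {ffun {set 'I_C.+1} * 'I_C.+1 * 'I_w -> bool}}| * #|H| + w).+1.
have free : copy_free H (gadget q C.+1 N K x y).
  exact (gadget_free xK yK xy WK Wcrit xW yW Kmin Kcore).
have [e [es [ei [Gmax e_sub]]]] := extend_maximal free.
exists (SGraph es ei); split=> //.
- exact: gadget_min_degree e_sub xK yK xy.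
- by apply/card_gt0P; exists (inl (true, x), (set0, ord0, ord0)).
have [U cU hU] := tK; have [Gfree _] := Gmax.
apply: (gadget_VC e_sub xK yK xy ord0 cU hU Gfree).
  by rewrite ltnS leq_addr.
by rewrite leqW // leq_addl.
Qed.

(** * Chromatic number and comparison of the thresholds *)

Lemma colorable_chromatic_number (H : sgraph) : colorable H (chromatic_number H).
Proof. by rewrite /chromatic_number; case: ex_minnP. Qed.

Lemma colorable_leq (H : sgraph) (j k : nat) : j <= k -> colorable H j -> colorable H k.
Proof.
move=> jk /existsP [c /forallP cP]; apply/existsP.
exists [ffun u => widen_ord jk (c u)]; apply/forallP => u; apply/forallP => v.
apply/implyP => uv; rewrite !ffunE.
by have /forallP /(_ v) /implyP /(_ uv) := cP u.
Qed.

Lemma not_colorable_lt (H : sgraph) (k : nat) :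
  k < chromatic_number H -> ~~ colorable H k.
Proof.
rewrite /chromatic_number; case: ex_minnP => n _ nmin.
by apply: contraL => /nmin; rewrite -leqNgt.
Qed.

Lemma min_degree_lt (G : sgraph) : 0 < #|G| -> min_degree G < #|G|.
Proof.
case/card_gt0P => v _; apply: leq_ltn_trans (min_degree_le v) _.
rewrite -cardsT; apply: proper_card; apply/properP; split; first exact: subsetT.
by exists v; rewrite !inE ?edge_irrefl.
Qed.

From mathcomp Require Import classical_sets.

Import Order.TTheory GRing.Theory Num.Theory.

Local Open Scope ring_scope.

Lemma mulr_one_minus_div (F : fieldType) (c d n : F) :
  c != 0 -> c * ((1 - d / c) * n) = (c - d) * n.
Proof. by move=> c0; field. Qed.

Section Thresholds.
Variables (R : realType) (H : sgraph).

Definition VC_set : set R := [set gamma : R | 0 <= gamma /\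
    exists C : nat, forall G : sgraph,
      maximal_copy_free H G -> gamma * #|G|%:R <= (min_degree G)%:R ->
      (VC G <= C)%N]%classic.

Definition B_set : set R := [set gamma : R | 0 <= gamma /\
    exists F : sgraph, forall G : sgraph,
      maximal_copy_free H G -> gamma * #|G|%:R <= (min_degree G)%:R ->
      is_blowup G F]%classic.

Lemma B_set_VC_set : (B_set `<=` VC_set)%classic.
Proof.
move=> gamma [g0 [F FP]]; split=> //; exists #|F| => G Gmax Gdeg.
exact/VC_blowup/FP.
Qed.

Lemma B_set_intro (gamma : R) (n0 : nat) : 0 <= gamma ->
  (forall G : sgraph, maximal_copy_free H G -> gamma * #|G|%:R <= (min_degree G)%:R ->
     (#|G| <= n0)%N) -> B_set gamma.
Proof.
move=> g0 small; split=> //; exists (universal n0) => G Gmax Gdeg.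
by apply: universal_blowup; apply: small.
Qed.

Lemma B_set1 : B_set 1.
Proof.
apply: (@B_set_intro _ 0%N) => // G _; rewrite mul1r ler_nat.
by have [->//|G0] := posnP #|G|; rewrite leqNgt min_degree_lt.
Qed.

Lemma has_lbound_VC : has_lbound VC_set.
Proof. by exists 0 => g []. Qed.

Lemma has_lbound_B : has_lbound B_set.
Proof. by exists 0 => g []. Qed.

Lemma delta_VC_le_delta_B : delta_VC R H <= delta_B R H.
Proof.
apply: lb_le_inf; first by exists 1; apply: B_set1.
move=> g Bg; apply: ge_inf; [exact: has_lbound_VC | exact: B_set_VC_set].
Qed.

Lemma delta_B_le (q a b : nat) : colorable H q.+2 -> (q.+1 * a < b)%N ->
  delta_B R H <= 1 - a%:R / b%:R.
Proof.
move=> col qab; have b0 : (0 < b)%N by lia.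
have b0R : 0 < b%:R :> R by rewrite ltr0n.
have [n0 n0P] := erdos_stone_min_degree qab #|H| (leqnn q.+2).
apply: ge_inf; first exact: has_lbound_B.
apply: (@B_set_intro _ n0).
  rewrite subr_ge0 ler_pdivrMr // mul1r ler_nat; nia.
move=> G [Gfree _] Gdeg; rewrite leqNgt; apply/negP => /ltnW big; apply: Gfree.
apply: (multipartite_copy col); apply: n0P => // v.
have le1 := min_degree_le v.
have le2 : (#|neighbours v| <= #|G|)%N := max_card _.
rewrite -(ler_nat R) !natrM natrB //.
have : (1 - a%:R / b%:R) * #|G|%:R <= #|neighbours v|%:R :> R.
  by apply: le_trans Gdeg _; rewrite ler_nat.
by move/(ler_wpM2l (ltW b0R)); rewrite mulr_one_minus_div ?gt_eqF //; lra.
Qed.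

(** With z = 2|H| - 1, the bound equals (zq + 1)/(z(q + 1) + 1), the degree ratio guaranteed by
    [large_VC_maximal_free] for every [C]. *)
Lemma delta_VC_ge (q : nat) : ~~ colorable H q.+2 ->
  1 - (2 * #|H| - 1)%N%:R / ((2 * #|H| - 1) * q.+1 + 1)%N%:R <= delta_VC R H.
Proof.
move=> ncol; apply: lb_le_inf; first by exists 1; apply/B_set_VC_set/B_set1.
move=> g [g0 [C CP]]; rewrite leNgt; apply/negP => lt.
have [G [Gmax Gdeg G0 GVC]] := large_VC_maximal_free C ncol.
have := CP G Gmax; rewrite leqNgt GVC => /(_ _) /negP; apply; last by [].
apply: le_trans (_ : _ <= (1 - (2 * #|H| - 1)%N%:R / ((2 * #|H| - 1) * q.+1 + 1)%N%:R) * #|G|%:R) _.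
  by rewrite ler_wpM2r // ltW.
move: Gdeg; rewrite -(ler_nat R); set z := (2 * #|H| - 1)%N.
set b : R := (z * q.+1 + 1)%N%:R; rewrite !natrM -/b => Gdeg.
have b0R : 0 < b by rewrite ltr0n addn1.
rewrite -(ler_pM2l b0R) mulr_one_minus_div ?gt_eqF //; apply: le_trans Gdeg; rewrite ler_wpM2r //.
by rewrite /b mulnS !natrD; lra.
Qed.

End Thresholds.

Theorem corollary1p7 (R : realType) (H1 H2 : sgraph)
  (chi1 : (2 <= chromatic_number H1)%N)
  (chi12 : (chromatic_number H1 < chromatic_number H2)%N) :
  [/\ delta_VC R H1 <= delta_B R H1,
      delta_B R H1 < delta_VC R H2 &
      delta_VC R H2 <= delta_B R H2].
Proof.
split; [exact: delta_VC_le_delta_B | | exact: delta_VC_le_delta_B].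
have [q eq] : exists q, chromatic_number H2 = q.+3.
  by exists (chromatic_number H2 - 3)%N; lia.
have col1 : colorable H1 q.+2.
  by apply: colorable_leq (colorable_chromatic_number H1); lia.
have ncol2 : ~~ colorable H2 q.+2 by apply: not_colorable_lt; rewrite eq.
set h := #|H2|.
(* The ratio z/(z(q + 1) + 1) increases with z and stays below 1/(q + 1). Taking z = 2h for [H1]
   against z = 2h - 1 for [H2] makes the inequality strict. *)
have lt1 : (q.+1 * (2 * h) < 2 * h * q.+1 + 1)%N by rewrite mulnC addn1.
apply: le_lt_trans (delta_B_le R col1 lt1) _.
apply: lt_le_trans (delta_VC_ge R ncol2); rewrite -/h ltrD2l ltrN2.
rewrite ltr_pdivrMr ?ltr0n ?addn1 // mulrAC ltr_pdivlMr ?ltr0n //.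
rewrite -!natrM ltr_nat.
have h0 : (0 < h)%N.
  rewrite lt0n; apply: contraNneq ncol2 => h0; apply/existsP.
  have noH (u : H2) : False by have : (0 < #|H2|)%N by [apply/card_gt0P; exists u]; rewrite -/h h0.
  by exists [ffun=> ord0]; apply/forallP => u; case: (noH u).
nia.
Qed.
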